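(* Let $1<p<\infty$, let $(X,d)$ be a $p$-uniformly convex space with parameter $c>0$, and let $T_1,T_2:X\to X$ be firmly nonexpansive mappings with $F:=\mathrm{Fix}(T_1)\cap\mathrm{Fix}(T_2)\neq\emptyset$. Let $x_0\in X$, $u\in F$ and $b>0$ be such that $d(x_0,u)\le b$. Define $(x_n)$ by $x_{n+1}=T_1x_n$ if $n$ is even and $x_{n+1}=T_2x_n$ if $n$ is odd ($n\in\mathbb{N}$). Then for all $\varepsilon>0$ and all $n\ge\theta(\varepsilon,b,c,p)$ we have $d(x_n,x_{n+1})\le\varepsilon$, where $$\theta(\varepsilon,b,c,p):=\begin{cases}2\left[\dfrac{2}{c}\left(\dfrac{4p\,b^p}{c\,\varepsilon^p}\right)^p\right] & \text{if }\varepsilon<2b,\\[2mm] 0&\text{otherwise.}\end{cases}$$ Moreover, for all $\varepsilon>0$, all $n\ge\tilde\theta(\varepsilon,b,c,p):=1+\theta(\varepsilon,b,c,p)$ and all $i\in\{1,2\}$, we have $d(x_n,T_ix_n)\le\varepsilon$.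
   Context: $\mathbb{N}=\{0,1,2,\ldots\}$; $[a]$ denotes the integer part (floor) of $a$; $\mathrm{Fix}(T)$ is the set of fixed points of $T$. In a geodesic metric space, $(1-t)x\oplus ty$ denotes the point $z$ on a geodesic segment from $x$ to $y$ with $d(z,x)=t\,d(x,y)$, $t\in[0,1]$. For $1<p<\infty$, a metric space $(X,d)$ is $p$-uniformly convex with parameter $c>0$ iff it is a geodesic space and for all $x,y,z\in X$ and $t\in[0,1]$, $$d(z,(1-t)x\oplus ty)^p\le(1-t)d(z,x)^p+t\,d(z,y)^p-\frac c2\,t(1-t)\,d(x,y)^p$$ (this implies that $X$ is uniquely geodesic). A mapping $T:C\to X$, with $C\subseteq X$ nonempty, is firmly nonexpansive iff $d(Tx,Ty)\le d((1-\lambda)x\oplus\lambda Tx,(1-\lambda)y\oplus\lambda Ty)$ for all $x,y\in C$ and all $\lambda\in[0,1)$. *)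

(* Defs.v *)
From HB Require Import structures.
From mathcomp Require Import all_boot all_order all_algebra.
From mathcomp Require Import all_classical all_reals all_analysis.

Set Implicit Arguments.
Unset Strict Implicit.
Unset Printing Implicit Defensive.

Import Order.TTheory GRing.Theory Num.Theory.

Local Open Scope classical_set_scope.
Local Open Scope ring_scope.

Section geodesic.
Context {R : realType} {X : metricType R}.

(* Only the restriction of [g] to [0, l] matters; the conditions force
   l = mdist x y. *)
Definition geodesic_path (x y : X) (l : R) (g : R -> X) : Prop :=
  [/\ 0 <= l, g 0 = x, g l = y &
      forall s t : R, 0 <= s <= l -> 0 <= t <= l ->
        mdist (g s) (g t) = `|s - t|].

Definition geodesic_segment (x y : X) (S : set X) : Prop :=
  exists l g, geodesic_path x y l g /\ S = g @` `[0, l].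

(* [convex_point t x y z] reads z = (1-t)x (+) ty. It is a relation because
   geodesics need not be unique in a general geodesic space; the definitions
   below quantify over all points so denoted. *)
Definition convex_point (t : R) (x y z : X) : Prop :=
  exists S, [/\ geodesic_segment x y S, S z & mdist z x = t * mdist x y].

Definition firmly_nonexpansive (C : set X) (T : X -> X) : Prop :=
  forall x y, C x -> C y -> forall t, 0 <= t < 1 ->
  forall v w, convex_point t x (T x) v -> convex_point t y (T y) w ->
  mdist (T x) (T y) <= mdist v w.

Definition Fix (T : X -> X) : set X := [set x | T x = x].

Fixpoint alternating_iter (T1 T2 : X -> X) (x0 : X) (n : nat) : X :=
  if n is m.+1 then
    let xm := alternating_iter T1 T2 x0 m in if odd m then T2 xm else T1 xm
  else x0.

End geodesic.

Definition geodesic_space {R : realType} (X : metricType R) : Prop :=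
  forall x y : X, exists S, geodesic_segment x y S.

Definition p_uniformly_convex {R : realType} (X : metricType R) (p c : R) :
    Prop :=
  geodesic_space X /\
  forall (x y z : X) (t : R), 0 <= t <= 1 -> forall w, convex_point t x y w ->
  mdist z w `^ p <= (1 - t) * mdist z x `^ p + t * mdist z y `^ p
                    - c / 2 * t * (1 - t) * mdist x y `^ p.

Definition theta {R : realType} (eps b c p : R) : int :=
  if eps < 2 * b then
    2 * Num.floor (2 / c * ((4 * p * b `^ p) / (c * eps `^ p)) `^ p)
  else 0.

(* Main.v *)
(** Let [d_n = d(x_n, x_(n+1))]. Uniform convexity together with firm
    nonexpansiveness gives [d(Tx,u)^p + c/2 d(x,Tx)^p <= d(x,u)^p] for every
    fixed point [u] of [T]. Along the iteration this bounds the sum of the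
    [d_n^p] by [2 b^p / c]. With [Q = 4 p b^p / (c eps^p)] it follows that,
    among the first [[2/c Q^p] + 1] even indices, some [2k] satisfies
    [d_(2k), d_(2k+1) <= b / Q], hence [d(x_(2k), x_(2k+2)) <= 2 b / Q]. The
    numbers [d_n] need not decrease, but [d(x_n, x_(n+2))] does, since [x_n] and [x_(n+2)] are moved by
    the same map. Hence [d(x_n, x_(n+2)) <= 2 b / Q] for all [n >= 2k], and
    [d_n^p <= 2/c (d(x_n,u)^p - d(x_(n+2),u)^p) <= 2/c p b^(p-1) (2 b / Q)],
    which is [eps^p]. *)

Require Import Defs.
From HB Require Import structures.
From mathcomp Require Import all_boot all_order all_algebra.
From mathcomp Require Import all_classical all_reals all_analysis.
From mathcomp Require Import ring lra zify.

Import Order.TTheory GRing.Theory Num.Theory.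

Local Open Scope classical_set_scope.
Local Open Scope ring_scope.

(* Young's inequality applied to [y] and [a `^ (p - 1)]. *)
Lemma powR_sub_le {R : realType} (p a y : R) : 1 < p -> 0 <= a -> 0 <= y ->
  a `^ p - y `^ p <= p * a `^ (p - 1) * (a - y).
Proof.
move=> p1 a0 y0; have p0 : 0 < p by lra.
have pB1 : 0 < p - 1 by lra.
have pneq0 : p != 0 by rewrite gt_eqF.
have q0 : 0 < p / (p - 1) by rewrite divr_gt0.
have conj : p^-1 + (p / (p - 1))^-1 = 1.
  by rewrite invf_div; field.
have := conjugate_powR y0 (powR_ge0 a (p - 1)) p0 q0 conj.
rewrite -powRrM (_ : (p - 1) * (p / (p - 1)) = p); last first.
  by field; rewrite gt_eqF.
rewrite -(ler_pM2l p0).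
have -> : p * (y `^ p / p + a `^ p / (p / (p - 1)))
    = y `^ p + (p - 1) * a `^ p by field; rewrite pneq0 gt_eqF.
have := mulr_powRB1 a0 p0.
set A := a `^ (p - 1) => <-; nra.
Qed.

Section geodesic_lemmas.
Context {R : realType} {X : metricType R}.
Implicit Types (x y z u : X) (T : X -> X) (p c t : R).

Lemma geodesic_pathE x y l (g : R -> X) :
  geodesic_path x y l g -> mdist x y = l.
Proof.
case=> l0 <- <- gE; rewrite gE ?lexx ?l0//.
by rewrite sub0r normrN ger0_norm.
Qed.

Lemma convex_point_exists x y t : geodesic_space X -> 0 <= t <= 1 ->
  exists z, convex_point t x y z.
Proof.
move=> /(_ x y)[S [l [g [gP _]]]] /andP[t0 t1].
have dE := geodesic_pathE _ _ _ _ gP; case: (gP) => l0 g0 gl gE.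
have tl0 : 0 <= t * l by rewrite mulr_ge0.
have tl : t * l <= l by rewrite ler_piMl.
exists (g (t * l)), (g @` `[0, l]); split.
- by exists l, g.
- by exists (t * l) => //=; rewrite in_itv/= tl0 tl.
- rewrite dE -[X in mdist _ X]g0 gE ?lexx ?l0 ?tl0 ?tl//.
  by rewrite subr0 ger0_norm.
Qed.

(** Parameter 0 turns firm nonexpansiveness into nonexpansiveness; this supplies the points needed
    for that. *)
Lemma convex_point0 x y : geodesic_space X -> convex_point 0 x y x.
Proof.
move=> gX; have [z xyz] : exists z, convex_point 0 x y z.
  by apply: convex_point_exists => //; rewrite lexx ler01.
case: (xyz) => S [_ _]; rewrite mul0r => /mdist_positivity zx.
by rewrite zx in xyz.
Qed.

Lemma convex_pointxx x t : geodesic_space X -> convex_point t x x x.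
Proof.
move=> gX; have [S [sS Sx]] := convex_point0 x x gX.
by rewrite mdistxx mul0r => _; exists S; split; rewrite ?mdistxx ?mulr0.
Qed.

Lemma firmly_nonexpansive_le T x y : geodesic_space X ->
  firmly_nonexpansive setT T -> mdist (T x) (T y) <= mdist x y.
Proof.
move=> gX hT; apply: (hT x y I I 0 _ x y); first by rewrite lexx ltr01.
- exact: convex_point0.
- exact: convex_point0.
Qed.

(** Apply uniform convexity to [u] and a point [w] at parameter [t] between [x] and [T x], bound
    [d(T x, u)] by [d(w, u)], divide by [1 - t] and let [t] tend to 1. *)
Lemma firmly_nonexpansive_fix_powR T p c x u : 0 < p ->
  p_uniformly_convex X p c -> firmly_nonexpansive setT T -> T u = u ->
  mdist (T x) u `^ p + c / 2 * mdist x (T x) `^ p <= mdist x u `^ p.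
Proof.
move=> p0 [gX uc] hT Tu.
set D' := mdist (T x) u `^ p; set D := mdist x u `^ p.
set E := c / 2 * mdist x (T x) `^ p.
have tE t : 0 < t < 1 -> D' + t * E <= D.
  move=> /andP[t0 t1]; have t01 : 0 <= t <= 1 by lra.
  have [w xw] := convex_point_exists x (T x) t gX t01.
  have Tw : D' <= mdist u w `^ p.
    rewrite (metric_sym u); apply: ge0_ler_powR;
      rewrite ?nnegrE ?mdist_ge0 ?(ltW p0)//.
    rewrite -{1}Tu; apply: (hT x u I I t _ w u) => //; first by lra.
    by rewrite Tu; exact: convex_pointxx.
  have := le_trans Tw (uc x (T x) u t t01 w xw).
  rewrite !(metric_sym u) -/D -/D' => H.
  have {}H : (1 - t) * (D' + t * E) <= (1 - t) * D by rewrite /E; lra.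
  by move: H; rewrite ler_pM2l//; lra.
have [E0|E0] := leP E 0.
  have := tE (1 / 2); have : 0 < (1 / 2 : R) < 1 by lra.
  by move=> h /(_ h); lra.
(* The limit is taken by contradiction: if [D < D' + E], then [tE] fails at any [t] strictly between
   [s = (D - D') / E] and 1, such as their midpoint. *)
rewrite leNgt; apply/negP => DE.
have D'D : 0 <= D - D'.
  have := tE (1 / 2); have : 0 < (1 / 2 : R) < 1 by lra.
  by move=> h /(_ h); lra.
pose s := (D - D') / E.
have s0 : 0 <= s by rewrite divr_ge0// ltW.
have s1 : s < 1 by rewrite ltr_pdivrMr//; lra.
have sE : s * E = D - D' by rewrite /s divfK// gt_eqF.
have /tE : 0 < (s + 1) / 2 < 1 by lra.
nra.
Qed.

End geodesic_lemmas.

Section alternating.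
Context {R : realType} {X : metricType R}.
Variables (p c : R) (T1 T2 : X -> X) (x0 u : X).
Hypotheses (hp : 1 < p) (hc : 0 < c) (hX : p_uniformly_convex X p c).
Hypotheses (hT1 : firmly_nonexpansive setT T1).
Hypotheses (hT2 : firmly_nonexpansive setT T2).
Hypotheses (hu : (Fix T1 `&` Fix T2) u).
Local Notation x := (alternating_iter T1 T2 x0).

Let gX : geodesic_space X. Proof. by case: hX. Qed.
Let p0 : 0 < p. Proof. exact: lt_trans hp. Qed.

Lemma alternating_powR n :
  mdist (x n.+1) u `^ p + c / 2 * mdist (x n) (x n.+1) `^ p
    <= mdist (x n) u `^ p.
Proof.
case: hu => u1 u2 /=.
by case: ifP => _; exact: firmly_nonexpansive_fix_powR.
Qed.

Lemma alternating_fejer n : mdist (x n.+1) u <= mdist (x n) u.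
Proof.
case: hu => u1 u2 /=; case: ifP => _.
- by rewrite -{1}u2; exact: firmly_nonexpansive_le.
- by rewrite -{1}u1; exact: firmly_nonexpansive_le.
Qed.

Lemma alternating_le0 n : mdist (x n) u <= mdist x0 u.
Proof. by elim: n => // n; apply: le_trans; exact: alternating_fejer. Qed.

Lemma alternating_step2_le m n : (m <= n)%N ->
  mdist (x n) (x n.+2) <= mdist (x m) (x m.+2).
Proof.
move=> /subnKC <-; elim: (n - m)%N => [|k]; first by rewrite addn0.
rewrite addnS; apply: le_trans; move: (m + k)%N => {k} {}n.
change (mdist (x n.+1) (if odd n.+2 then T2 (x n.+2) else T1 (x n.+2)) <=
  mdist (x n) (x n.+2)).
change (mdist (if odd n then T2 (x n) else T1 (x n))
  (if odd n.+2 then T2 (x n.+2) else T1 (x n.+2)) <= mdist (x n) (x n.+2)).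
(* [n] and [n.+2] have the same parity, so a single nonexpansive map sends both points one step
   further. *)
rewrite [odd n.+2]/= negbK.
by case: (odd n); exact: firmly_nonexpansive_le.
Qed.

(** By the triangle inequality, a double step longer than [2 * e] contains a step of length at least
    [e], so it lowers [d(., u)^p] by at least [c / 2 * e^p]. *)
Lemma alternating_count (e : R) K : 0 <= e ->
  (forall k, (k < K)%N -> 2 * e < mdist (x k.*2) (x k.*2.+2)) ->
  K%:R * (c / 2 * e `^ p) <= mdist x0 u `^ p.
Proof.
(* The induction must keep the remaining term [d(x_(2K), u)^p] for the drops to telescope. *)
move=> e0 H; suff : K%:R * (c / 2 * e `^ p) + mdist (x K.*2) u `^ p
    <= mdist x0 u `^ p by have := powR_ge0 (mdist (x K.*2) u) p; lra.
elim: K H => [|K IH] H; first by rewrite mul0r add0r.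
have {}IH := IH (fun k kK => H k (ltnW kK)).
have A := alternating_powR K.*2; have B := alternating_powR K.*2.+1.
have tri := metric_triangle (x K.*2) (x K.*2.+1) (x K.*2.+2).
have HK := H K (ltnSn K).
rewrite doubleS -natr1 mulrDl mul1r.
set d1 := mdist (x K.*2) (x K.*2.+1) in A tri.
set d2 := mdist (x K.*2.+1) (x K.*2.+2) in B tri.
have c2 : 0 < c / 2 by rewrite divr_gt0.
suff : c / 2 * e `^ p <= c / 2 * d1 `^ p + c / 2 * d2 `^ p by lra.
have h1 : 0 <= c / 2 * d1 `^ p by rewrite mulr_ge0 ?powR_ge0// ltW.
have h2 : 0 <= c / 2 * d2 `^ p by rewrite mulr_ge0 ?powR_ge0// ltW.
have le d : e <= d -> c / 2 * e `^ p <= c / 2 * d `^ p.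
  move=> ed; rewrite ler_pM2l//.
  apply: ge0_ler_powR; rewrite ?nnegrE ?(ltW p0)//.
  exact: le_trans ed.
have [/le|ed1] := leP e d1; first by lra.
have /le : e <= d2 by lra.
lra.
Qed.

(* The decrease of [d(x_n,u)^p] over two steps controls that over one. *)
Lemma alternating_step_powR (b : R) n : mdist x0 u <= b ->
  mdist (x n) (x n.+1) `^ p
    <= 2 / c * (p * b `^ (p - 1) * mdist (x n) (x n.+2)).
Proof.
move=> ub; have A := alternating_powR n.
have B : mdist (x n.+2) u `^ p <= mdist (x n.+1) u `^ p.
  apply: ge0_ler_powR; rewrite ?nnegrE ?mdist_ge0 ?(ltW p0)//.
  by rewrite alternating_fejer.
have C := powR_sub_le _ _ _ hp (mdist_ge0 (x n) u) (mdist_ge0 (x n.+2) u).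
have D : mdist (x n) u - mdist (x n.+2) u <= mdist (x n) (x n.+2).
  by rewrite lerBlDr metric_triangle.
have E : mdist (x n) u `^ (p - 1) <= b `^ (p - 1).
  have nb := le_trans (alternating_le0 n) ub.
  apply: ge0_ler_powR; rewrite ?nnegrE ?mdist_ge0//.
    by rewrite subr_ge0 ltW.
  exact: le_trans (mdist_ge0 _ _) nb.
have F : p * mdist (x n) u `^ (p - 1) * (mdist (x n) u - mdist (x n.+2) u)
    <= p * b `^ (p - 1) * mdist (x n) (x n.+2).
  apply: (@le_trans _ _ (p * mdist (x n) u `^ (p - 1) * mdist (x n) (x n.+2))).
    by rewrite ler_wpM2l// mulr_ge0 ?powR_ge0// ltW.
  by rewrite ler_wpM2r ?mdist_ge0// ler_pM2l.
have c2 : 0 < c / 2 by rewrite divr_gt0.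
rewrite -(ler_pM2l c2) mulrA.
have -> : c / 2 * (2 / c) = 1 by field; rewrite gt_eqF.
lra.
Qed.

Lemma alternating_asymptotic_regularity (b eps : R) n : 0 < b ->
  mdist x0 u <= b -> 0 < eps -> theta eps b c p <= n%:Z ->
  mdist (x n) (x n.+1) <= eps.
Proof.
move=> b0 ub eps0; rewrite /theta; case: ifPn => [_|]; last first.
  rewrite -leNgt => b2 _; apply: le_trans b2.
  apply: le_trans (metric_triangle _ u _) _.
  rewrite (metric_sym u).
  have := alternating_le0 n; have := alternating_le0 n.+1; lra.
set Q := 4 * p * b `^ p / (c * eps `^ p); set M := 2 / c * Q `^ p.
have bp0 : 0 < b `^ p by rewrite powR_gt0.
have ep0 : 0 < eps `^ p by rewrite powR_gt0.
have Q0 : 0 < Q by rewrite divr_gt0 ?mulr_gt0.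
have M0 : 0 <= M by rewrite mulr_ge0 ?powR_ge0// divr_ge0 ?ltW.
have : 0 <= Num.floor M by rewrite floor_ge0.
have := floorD1_gt M.
(* Now [theta] is [2 * N] with [N] natural and [M < N.+1], so [N.+1] even indices are available. *)
case: (Num.floor M) => // N MN _ Nn.
have {}MN : M < N.+1%:R by move: MN; rewrite -natr1 intrD.
have [k kN dk] : exists2 k, (k <= N)%N &
    mdist (x k.*2) (x k.*2.+2) <= 2 * (b / Q).
  apply: contrapT => /forall2NP H.
  have e0 : 0 <= b / Q by rewrite divr_ge0 ?ltW.
  have := alternating_count (b / Q) N.+1 e0.
  have /[swap]/[apply] : forall k, (k < N.+1)%N ->
      2 * (b / Q) < mdist (x k.*2) (x k.*2.+2).
    by move=> k kN; rewrite ltNge; apply/negP; case: (H k).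
  apply/negP; rewrite -ltNge; apply: (@le_lt_trans _ _ (b `^ p)).
    by apply: ge0_ler_powR; rewrite ?nnegrE ?mdist_ge0 ?(ltW p0) ?(ltW b0).
  rewrite powRM ?invr_ge0 ?ltW// -(powR_inv1 (ltW Q0)).
  rewrite -powRrM mulN1r powRN.
  have Qp0 : 0 < Q `^ p by rewrite powR_gt0.
  (* [M] is exactly the number of drops [c / 2 * (b / Q)^p] that would use up [b^p]; [N.+1] of them
     are too many. *)
  have {1}-> : b `^ p = M * (c / 2 * (b `^ p / Q `^ p)).
    by rewrite /M; field; rewrite !gt_eqF.
  by rewrite ltr_pM2r// mulr_gt0 ?divr_gt0.
have kn : (k.*2 <= n)%N by lia.
have dn := le_trans (alternating_step2_le _ _ kn) dk.
rewrite leNgt; apply/negP => lt_eps.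
have : eps `^ p < mdist (x n) (x n.+1) `^ p.
  by apply: gt0_ltr_powR; rewrite ?nnegrE ?mdist_ge0 ?ltW.
apply/negP; rewrite -leNgt.
apply: le_trans (alternating_step_powR b n ub) _.
have bp1 : 0 < b `^ (p - 1) by rewrite powR_gt0.
apply: (@le_trans _ _ (2 / c * (p * b `^ (p - 1) * (2 * (b / Q))))).
  by rewrite !ler_wpM2l// ?divr_ge0 ?mulr_ge0 ?ltW.
(* The choice of [Q] makes the bound equal to [eps^p], once [b^p] is split as [b * b^(p - 1)]. *)
rewrite /Q -(mulr_powRB1 (ltW b0) p0) le_eqVlt; apply/orP; left; apply/eqP.
by field; rewrite !gt_eqF.
Qed.

End alternating.

Theorem theorem3p4 (R : realType) (X : metricType R) (p c : R)
    (hp : 1 < p) (hc : 0 < c) (hX : p_uniformly_convex X p c)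
    (T1 T2 : X -> X)
    (hT1 : firmly_nonexpansive setT T1) (hT2 : firmly_nonexpansive setT T2)
    (hF : Fix T1 `&` Fix T2 !=set0)
    (x0 u : X) (b : R) (hu : (Fix T1 `&` Fix T2) u) (hb : 0 < b)
    (hub : mdist x0 u <= b) :
  let x := alternating_iter T1 T2 x0 in
  (forall eps : R, 0 < eps -> forall n : nat, theta eps b c p <= n%:Z ->
     mdist (x n) (x n.+1) <= eps) /\
  (forall eps : R, 0 < eps -> forall n : nat, 1 + theta eps b c p <= n%:Z ->
     mdist (x n) (T1 (x n)) <= eps /\ mdist (x n) (T2 (x n)) <= eps).
Proof.
move=> x; have reg eps n : 0 < eps -> theta eps b c p <= n%:Z ->
    mdist (x n) (x n.+1) <= eps.
  by move=> e0; exact: (@alternating_asymptotic_regularity _ _ _ _ _ _ _ u).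
split=> [eps e0 n|eps e0 n nth]; first exact: reg.
have th0 : 0 <= theta eps b c p.
  rewrite /theta; case: ifP => // _; rewrite mulr_ge0// floor_ge0.
  by rewrite mulr_ge0 ?powR_ge0// divr_ge0 ?ltW.
(* The extra 1 in the rate guarantees a predecessor whose own step is already at most [eps]. *)
case: n nth => [|n] nth; first by lia.
have gX : geodesic_space X by case: hX.
have xn : mdist (x n) (x n.+1) <= eps by apply: reg => //; lia.
have xn1 : mdist (x n.+1) (x n.+2) <= eps by apply: reg => //; lia.
(* This handles the map that has just been applied; the other map produces the next iterate, so
   [xn1] covers it. *)
have same T : firmly_nonexpansive setT T -> x n.+1 = T (x n) ->
    mdist (x n.+1) (T (x n.+1)) <= eps.
  move=> hT xT; rewrite {1}xT; apply: le_trans xn.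
  exact: firmly_nonexpansive_le.
have xS m : x m.+1 = if odd m then T2 (x m) else T1 (x m) by [].
move: xn1; rewrite (xS n.+1) /=; case: (boolP (odd n)) => /= on xn1.
- by split=> //; apply: same; rewrite // xS on.
- by split=> //; apply: same; rewrite // xS (negbTE on).
Qed.
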